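(* Let $p$ be a prime number, let $k$ be a natural number with $2^{k}<p$, and let $(A,+,\circ)$ be a strongly nilpotent $\mathbb{F}_{p}$-brace of nilpotency index $k$. Write $a*b=a\circ b-a-b$, and let $(A,+,\cdot)$ be the nilpotent pre-Lie algebra over $\mathbb{F}_{p}$ with the same addition as the brace and with multiplication $$a\cdot b=-\sum_{i=0}^{p-2}\frac{1}{2^{i}}\bigl((2^{i}a)*b\bigr)\qquad(a,b\in A),$$ where $2^{i}a$ denotes the sum of $2^{i}$ copies of $a$ and $\frac{1}{2^{i}}$ denotes the inverse of $2^{i}$ in $\mathbb{F}_{p}$. Then $(A,\circ)$ is the group of flows of the pre-Lie algebra $(A,+,\cdot)$; that is, the brace $(A,+,\circ)$ coincides with the brace obtained from the pre-Lie algebra $(A,+,\cdot)$ by the group of flows construction.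
   Context: A left brace is a set $A$ with operations $+,\circ$ such that $(A,+)$ is an abelian group, $(A,\circ)$ is a group, and $a\circ(b+c)+a=a\circ b+a\circ c$ for all $a,b,c\in A$. One writes $a*b=a\circ b-a-b$. For a field $\mathbb{F}$, an $\mathbb{F}$-brace is a left brace whose additive group is an $\mathbb{F}$-vector space with $a*(\alpha b)=\alpha(a*b)$ for all $a,b\in A$, $\alpha\in\mathbb{F}$. $\mathbb{F}_p$ is the field with $p$ elements. Nilpotency index of a brace: for subsets $X,Y\subseteq A$, $X*Y$ is the set of all finite sums of elements $x*y$, $x\in X$, $y\in Y$; put $A^{[1]}=A$ and $A^{[i+1]}=\sum_{j=1}^{i}A^{[j]}*A^{[i+1-j]}$. $A$ is strongly nilpotent if some $A^{[n]}=0$, and has nilpotency index $k$ if $A^{[k]}=0$ and $A^{[k-1]}\neq0$. A pre-Lie algebra over a field is a vector space with a bilinear operation $\cdot$ satisfying $(x\cdot y)\cdot z-x\cdot(y\cdot z)=(y\cdot x)\cdot z-y\cdot(x\cdot z)$ for all $x,y,z$. It is nilpotent of nilpotency index $n$ if all products of any $n$ elements (with any bracketing) are zero and $n$ is minimal with this property. Group of flows: let $(A,+,\cdot)$ be a nilpotent pre-Lie algebra over $\mathbb{F}_p$ of nilpotency index $k<p$. For $a\in A$ let $L_a(b)=a\cdot b$ and $e^{L_a}(b)=b+a\cdot b+\frac1{2!}a\cdot(a\cdot b)+\frac1{3!}a\cdot(a\cdot(a\cdot b))+\cdots$, where the sum stops at place $k$ (all products of $k$ or more elements vanish). Let $W(a)=a+\frac1{2!}a\cdot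 a+\frac1{3!}a\cdot(a\cdot a)+\cdots$, again stopping at place $k$. The map $W:A\to A$ is bijective; let $\Omega$ be its inverse. Define $a\circ b=a+e^{L_{\Omega(a)}}(b)$. Then $(A,+,\circ)$, with the same addition, is a left brace, and $(A,\circ)$ (or the brace $(A,+,\circ)$) is called the group of flows of the pre-Lie algebra $(A,+,\cdot)$. *)

(* Defs.v *)
From mathcomp Require Import all_boot all_order all_algebra.
From mathcomp Require Import boolp classical_sets.

Set Implicit Arguments.
Unset Strict Implicit.
Unset Printing Implicit Defensive.

Import GRing.Theory.
Local Open Scope classical_set_scope.
Local Open Scope ring_scope.

Definition group_law (T : Type) (op : T -> T -> T) : Prop :=
  exists (e : T) (inv : T -> T),
    [/\ associative op, left_id e op, right_id e op,
        left_inverse e inv op & right_inverse e inv op].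

Definition left_brace (A : zmodType) (circ : A -> A -> A) : Prop :=
  group_law circ /\
  forall a b c : A, circ a (b + c) + a = circ a b + circ a c.

Definition brace_star (A : zmodType) (circ : A -> A -> A) (a b : A) : A :=
  circ a b - a - b.

Definition field_brace (F : fieldType) (A : lmodType F)
    (circ : A -> A -> A) : Prop :=
  left_brace circ /\
  forall (a b : A) (c : F),
    brace_star circ a (c *: b) = c *: brace_star circ a b.

Definition star_set (A : zmodType) (circ : A -> A -> A) (X Y : set A) : set A :=
  [set z | exists2 s : seq (A * A),
     (forall u, u \in s -> X u.1 /\ Y u.2) &
     z = \sum_(u <- s) brace_star circ u.1 u.2].

Definition sum_sets (A : zmodType) (n : nat) (X : 'I_n -> set A) : set A :=
  [set z | exists2 f : 'I_n -> A, (forall j, X j (f j)) & z = \sum_j f j].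

(* The list [:: A^[1]; ...; A^[n+1]]: the recursion is course-of-values.
   The entry of index j is A^[j+1], so the set appended below is A^[m+2], with
   summands A^[j+1] * A^[m+2-(j+1)] for j < m+1. *)
Fixpoint brace_powers (A : zmodType) (circ : A -> A -> A) (n : nat) :
    seq (set A) :=
  if n is m.+1 then
    let s := brace_powers circ m in
    rcons s (sum_sets (fun j : 'I_m.+1 =>
      star_set circ (nth set0 s j) (nth set0 s (m - j))))
  else [:: setT].

(* A^[n], for n >= 1; the value at n = 0 is irrelevant. *)
Definition brace_pow (A : zmodType) (circ : A -> A -> A) (n : nat) : set A :=
  nth set0 (brace_powers circ n.-1) n.-1.

Lemma size_brace_powers (A : zmodType) (circ : A -> A -> A) (n : nat) :
  size (brace_powers circ n) = n.+1.
Proof. by elim: n => //= n IHn; rewrite size_rcons IHn. Qed.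

Lemma nth_brace_powers (A : zmodType) (circ : A -> A -> A) (n j : nat) :
  (j <= n)%N -> nth set0 (brace_powers circ n) j = brace_pow circ j.+1.
Proof.
elim: n => [|n IHn]; first by rewrite leqn0 => /eqP->.
rewrite leq_eqVlt => /orP[/eqP-> //|]; rewrite ltnS => le_jn.
by rewrite /= nth_rcons size_brace_powers ltnS le_jn IHn.
Qed.

Lemma brace_pow1 (A : zmodType) (circ : A -> A -> A) :
  brace_pow circ 1 = setT.
Proof. by []. Qed.

Lemma brace_powS (A : zmodType) (circ : A -> A -> A) (n : nat) :
  (0 < n)%N ->
  brace_pow circ n.+1 =
  sum_sets (fun j : 'I_n =>
    star_set circ (brace_pow circ j.+1) (brace_pow circ (n.+1 - j.+1))).
Proof.
case: n => // n _; rewrite {1}/brace_pow /= nth_rcons size_brace_powers.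
rewrite ltnn eqxx; congr sum_sets; apply: funext => j.
have le_jn : (j <= n)%N by rewrite -ltnS ltn_ord.
by rewrite (nth_brace_powers _ le_jn) (nth_brace_powers _ (leq_subr j n)) subSS subSn.
Qed.

(* A^[0] does not exist, so the second condition is void for k = 1: the zero
   brace, and only it, has nilpotency index 1. *)
Definition brace_nilpotency_index (A : zmodType) (circ : A -> A -> A)
    (k : nat) : Prop :=
  [/\ (0 < k)%N, brace_pow circ k = [set 0] &
      (1 < k)%N -> brace_pow circ k.-1 <> [set 0]].

Definition pre_lie (F : fieldType) (A : lmodType F) (dot : A -> A -> A) : Prop :=
  [/\ forall a, linear (dot a),
      forall b, linear (dot^~ b) &
      forall x y z, dot (dot x y) z - dot x (dot y z) =
                    dot (dot y x) z - dot y (dot x z)].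

Inductive bracketed_product (A : Type) (dot : A -> A -> A) : nat -> A -> Prop :=
| Bracketed_leaf a : bracketed_product dot 1 a
| Bracketed_node m n a b :
    bracketed_product dot m a -> bracketed_product dot n b ->
    bracketed_product dot (m + n) (dot a b).

Definition products_vanish (A : zmodType) (dot : A -> A -> A) (n : nat) : Prop :=
  forall z, bracketed_product dot n z -> z = 0.

Definition pre_lie_nilpotency_index (A : zmodType) (dot : A -> A -> A)
    (n : nat) : Prop :=
  [/\ (0 < n)%N, products_vanish dot n &
      forall m, (0 < m)%N -> products_vanish dot m -> (n <= m)%N].

(* e^{L_a}(b) and W(a) for a nilpotency index n: the omitted terms, and the
   last one kept, are products of at least n elements and hence vanish. *)
Definition flow_exp (F : fieldType) (A : lmodType F) (dot : A -> A -> A)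
    (n : nat) (a b : A) : A :=
  \sum_(i < n) (i`!%:R : F)^-1 *: iter i (dot a) b.

Definition flow_W (F : fieldType) (A : lmodType F) (dot : A -> A -> A)
    (n : nat) (a : A) : A :=
  \sum_(i < n) ((i.+1)`!%:R : F)^-1 *: iter i (dot a) a.

(* (A, +, dot) is a nilpotent pre-Lie algebra over F_p of nilpotency index
   n < p, and circ is the operation of its group of flows; Omega, being a
   two-sided inverse of W, is unique. *)
Definition group_of_flows (p : nat) (A : lmodType 'F_p)
    (dot circ : A -> A -> A) : Prop :=
  exists n : nat,
    [/\ pre_lie dot, pre_lie_nilpotency_index dot n, (n < p)%N &
        exists Omega : A -> A,
          [/\ cancel (flow_W dot n) Omega, cancel Omega (flow_W dot n) &
              forall a b, circ a b = a + flow_exp dot n (Omega a) b]].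

Definition brace_dot (p : nat) (A : lmodType 'F_p) (circ : A -> A -> A)
    (a b : A) : A :=
  - \sum_(i < p.-1) ((2 ^ i)%N%:R : 'F_p)^-1 *: brace_star circ (a *+ (2 ^ i)%N) b.

(* Main.v *)
Require Import Defs.
From mathcomp Require Import all_boot all_order all_algebra.
From mathcomp Require Import boolp classical_sets.
From mathcomp Require Import finfield.

(** Write [a ** b] for [brace_star circ a b] and [dot] for the pre-Lie product.
    The product [a ** b] is polynomial in its left argument [a], and the
    element [dot a b] is its derivative at [a = 0].  The brace and the
    pre-Lie algebra are thus related as a group and its Lie algebra are, and the
    theorem follows by calculus.  Strong nilpotency keeps all degrees below
    [k], hence below [p], which is what makes calculus valid over ['F_p].

    Polynomiality.  Call a map [f] from a commutative monoid to [A] polynomial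
    if its [n]-fold finite differences take values in [A^[n]], for all [n].  If
    [f] and [g] are polynomial, so is [f ** g] ([poly_upto_star]); this is the
    brace version of the theorem of Lazard and Leibman on polynomial maps into
    filtered groups.  By Newton's interpolation formula a polynomial map of a
    natural number [t] has the form [\sum_(m < k) c m *+ t ^ m] with [c m] in
    [A^[m]] ([poly_map_expansion]).

    The linear coefficient.  The weighted sum over powers of 2 that defines
    [dot] kills the monomials of degree other than 1 and below [k], since
    [2 ^ m != 2] in ['F_p] for these degrees; so it computes the coefficient
    [c 1] ([lin_coef]).  On the diagonal of a polynomial map of two variables
    it is the sum of the two partial coefficients ([lin_coef_diag]), which gives
    additivity of [dot] on the left and the chain rule.  The pre-Lie
    identity expresses that [a |-> (b |-> b + a ** b)] is an action of the circle
    group: the coefficient of [t * s] in [circ (t x) (s y) ** z] is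
    [dot x (dot y z)], and it differs from [dot (dot x y) z] by the coefficient
    of [t * s] in [(t x + s y) ** z], which is symmetric in [x] and [y].

    The flow.  For [a] in [A] the circle powers of [a] form a polynomial
    one-parameter subgroup [circ_pow a]; let [x = circ_log a] be its linear
    coefficient.  The derivative of [t |-> b + circ_pow a t ** b] is the same
    map with [dot x b] in place of [b], so Taylor's formula at [t = 1] says
    [b + a ** b = e^(L_x) b] ([circ_exp]); applied to [circ_pow a] itself it
    says [a = W x] ([circ_log_exp]).  As [W] is injective by nilpotency,
    [circ_log] is the inverse of [W], and
    [circ a b = a + (b + a ** b) = a + e^(L_(Omega a)) b]. *)

Set Implicit Arguments.
Unset Strict Implicit.
Unset Printing Implicit Defensive.

Import GRing.Theory.
Local Open Scope ring_scope.

(** * The circle group of a brace and its action *)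

Section LeftBrace.

Variables (A : zmodType) (circ : A -> A -> A).
Hypothesis circ_brace : left_brace circ.

Local Notation "a ** b" := (brace_star circ a b) (at level 40).

Lemma circE a b : circ a b = a + b + a ** b.
Proof. by rewrite addrC /brace_star -[circ a b - a - b]addrA -opprD subrK. Qed.

Lemma starDr a b c : a ** (b + c) = a ** b + a ** c.
Proof.
have [_ /(_ a b c) dist] := circ_brace.
rewrite /brace_star.
have -> : circ a (b + c) = circ a b + circ a c - a by rewrite -dist addrK.
by rewrite [RHS]addrACA -opprD [X in _ = X - _]addrACA !addrA.
Qed.

Lemma starr0 a : a ** 0 = 0.
Proof. by apply: (addrI (a ** 0)); rewrite -starDr !addr0. Qed.

Lemma starNr a b : a ** (- b) = - (a ** b).
Proof. by apply: (addrI (a ** b)); rewrite -starDr !subrr starr0. Qed.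

Lemma starBr a b c : a ** (b - c) = a ** b - a ** c.
Proof. by rewrite starDr starNr. Qed.

Lemma starMnr a b n : a ** (b *+ n) = (a ** b) *+ n.
Proof. by elim: n => [|n IH]; rewrite ?starr0 // !mulrS starDr IH. Qed.

Lemma circr0 a : circ a 0 = a.
Proof. by rewrite circE starr0 !addr0. Qed.

Lemma circ0r a : circ 0 a = a.
Proof.
have [[e [inv [_ l1 _ _ _]]] _] := circ_brace.
by have e0 : e = 0; [rewrite -(circr0 e) l1 | rewrite -{1}e0 l1].
Qed.

Lemma star0r a : 0 ** a = 0.
Proof. by rewrite /brace_star circ0r subr0 subrr. Qed.

Lemma circA : associative circ.
Proof. by have [[e [inv []]]] := circ_brace. Qed.

Lemma circ_inv a : exists b, circ a b = 0 /\ circ b a = 0.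
Proof.
have [[e [inv [_ l1 _ li ri]]] _] := circ_brace.
have e0 : e = 0 by rewrite -(circr0 e) l1.
by exists (inv a); rewrite li ri e0.
Qed.

(** The map [b |-> b + a ** b] is the additive automorphism through which [a]
    acts; this is the statement that the action is one of the circle group. *)
Lemma star_circ a b c : circ a b ** c = a ** c + b ** c + a ** (b ** c).
Proof.
apply: (addrI (circ a b + c)); rewrite -circE -circA.
rewrite [circ b c]circE [circ a (_ + _)]circE !starDr (circE a b).
by rewrite [LHS](AC (1*3*3) ((((1*2)*5)*3)*(6*4*7))%AC).
Qed.

(** Adding [b] to [a] is multiplying [a] on the right by the preimage [u] of [b]
    under the action of [a]: this converts sums, on which [**] has no simple
    law on the left, into circle products, on which it has one. *)
Lemma add_circ_decomp a b : exists2 u, a + b = circ a u & u + a ** u = b.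
Proof.
have [c [ac ca]] := circ_inv a.
exists (circ c (a + b)); first by rewrite circA ac circ0r.
by apply: (addrI a); rewrite addrA -circE circA ac circ0r.
Qed.

End LeftBrace.

(** * The filtration of a brace by its powers *)

Section BracePowers.

Variables (A : zmodType) (circ : A -> A -> A).
Hypothesis circ_brace : left_brace circ.

Local Notation "a ** b" := (brace_star circ a b) (at level 40).
Local Notation fil := (brace_pow circ).

Lemma brace_pow_le1 d a : (d <= 1)%N -> fil d a.
Proof. by case: d => [|[|]]. Qed.

(** The sets [star_set] consist of sums of products, so closure under addition
    is concatenation, while [- (x ** y) = x ** (- y)] moves a sign to the right
    factor, which lies in an earlier term of the filtration: whence the strong
    induction. *)
Lemma brace_pow_zmod d :
  [/\ fil d 0, forall a b, fil d a -> fil d b -> fil d (a + b)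
    & forall a, fil d a -> fil d (- a)].
Proof.
elim/ltn_ind: d => -[|[|d]] IH //; rewrite brace_powS //; split.
- exists (fun _ => 0) => [j|]; last by rewrite big1.
  by exists [::] => //; rewrite big_nil.
- move=> _ _ [f hf ->] [g hg ->]; exists (fun j => f j + g j).
    move=> j; have [s hs ->] := hf j; have [s' hs' ->] := hg j.
    exists (s ++ s') => [u|]; last by rewrite big_cat.
    by rewrite mem_cat => /orP[/hs|/hs'].
  by rewrite big_split.
- move=> _ [f hf ->]; exists (fun j => - f j); last by rewrite sumrN.
  move=> j; have [s hs ->] := hf j.
  exists [seq (u.1, - u.2) | u <- s].
    move=> _ /mapP[u /hs [u1 u2] ->]; split=> //=.
    by have [|_ _] := IH (d.+2 - j.+1)%N; [rewrite ltn_subrL | apply].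
  by rewrite big_map -sumrN; apply: eq_bigr => u _; rewrite starNr.
Qed.

Lemma brace_pow0 d : fil d 0. Proof. by case: (brace_pow_zmod d). Qed.

Lemma brace_powD d a b : fil d a -> fil d b -> fil d (a + b).
Proof. by case: (brace_pow_zmod d) => _ + _; apply. Qed.

Lemma brace_powN d a : fil d a -> fil d (- a).
Proof. by case: (brace_pow_zmod d) => _ _; apply. Qed.

Lemma brace_pow_sum d (I : Type) (r : seq I) (P : pred I) (f : I -> A) :
  (forall i, P i -> fil d (f i)) -> fil d (\sum_(i <- r | P i) f i).
Proof.
by move=> hf; apply: big_ind => //; [apply: brace_pow0 | apply: brace_powD].
Qed.

Lemma brace_pow_mulrn d n a : fil d a -> fil d (a *+ n).
Proof.
move=> fa; elim: n => [|n IH]; first exact: brace_pow0.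
by rewrite mulrS; apply: brace_powD.
Qed.

Lemma brace_pow_star_pos i j a b :
  (0 < i)%N -> (0 < j)%N -> fil i a -> fil j b -> fil (i + j) (a ** b).
Proof.
case: i j => [|i] [|j] // _ _ fa fb.
rewrite addSn brace_powS; last by rewrite addnS.
have lt_i : (i < i + j.+1)%N by rewrite -addSnnS leq_addr.
exists (fun l => if l == Ordinal lt_i then a ** b else 0).
  move=> l; case: eqP => [-> /=|_].
    exists [:: (a, b)]; last by rewrite big_seq1.
    by move=> u; rewrite inE => /eqP ->; rewrite -addSn addKn.
  by exists [::] => //; rewrite big_nil.
by rewrite -big_mkcond /= big_pred1_eq.
Qed.

(** For [d > 1], one of the two indices in a product of [A^[i]] and
    [A^[d.+1 - i]] exceeds 1 and can be lowered by the induction hypothesis. *)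
Lemma brace_pow_decr d a : fil d.+1 a -> fil d a.
Proof.
elim/ltn_ind: d a => -[|[|d]] IH //= a; rewrite brace_powS // => -[f hf ->].
apply: brace_pow_sum => j _; have [s hs ->] := hf j; rewrite big_seq.
apply: brace_pow_sum => u /hs [].
case: j {hs} => -[|j] /= ltj; rewrite subSS => f1 f2.
  rewrite -[d.+2]add1n; apply: brace_pow_star_pos => //.
  by apply: IH => //; rewrite subn0 in f2.
have -> : d.+2 = (j.+1 + (d.+2 - j.+1))%N by rewrite subnKC // ltnW.
apply: brace_pow_star_pos => //; first by rewrite subn_gt0.
exact: IH.
Qed.

Lemma brace_pow_mono i j a : (i <= j)%N -> fil j a -> fil i a.
Proof.
move=> /subnK <-; elim: (j - i)%N => // n IH; rewrite addSn => /brace_pow_decr.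
exact: IH.
Qed.

Lemma brace_pow_starS j a b : fil j b -> fil j.+1 (a ** b).
Proof.
case: j => [|j] fb; first exact: brace_pow_le1.
by rewrite -add1n; apply: brace_pow_star_pos.
Qed.

(** The indices 0 and 1 both stand for the whole of [A].  Index 0 is allowed
    because degree 0 is the one of the values of a polynomial map. *)
Lemma brace_pow_star i j a b : fil i a -> fil j b -> fil (i + j) (a ** b).
Proof.
case: i => [|i] fa; first by move=> /(brace_pow_starS a) /brace_pow_decr.
case: j => [|j] fb; last exact: brace_pow_star_pos.
rewrite addn0; apply: brace_pow_decr; rewrite -addn1.
exact: brace_pow_star_pos.
Qed.

End BracePowers.

(** * Polynomial maps into the filtered brace *)

Section FilteredPolynomialMaps.

Variables (A : zmodType) (circ : A -> A -> A) (k : nat).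
Hypothesis circ_brace : left_brace circ.
Hypothesis nilp : brace_pow circ k = [set 0]%classic.

Local Notation "a ** b" := (brace_star circ a b) (at level 40).
Local Notation fil := (brace_pow circ).

Lemma brace_pow_nilp d a : (k <= d)%N -> fil d a -> a = 0.
Proof. by move=> kd /(brace_pow_mono circ_brace kd); rewrite nilp. Qed.

(** The values of [f] lie in [A^[d]], and every step of finite differences, for
    at most [N] steps, gains one degree.  The bound [N] is there for inductions:
    the hypothesis with [N] differences suffices for a conclusion with [N]
    differences, while the degree [d] varies freely. *)
Fixpoint poly_upto (V : nmodType) (N d : nat) (f : V -> A) : Prop :=
  (forall v, fil d (f v)) /\
  if N is N'.+1 then forall h, poly_upto N' d.+1 (fun v => f (v + h) - f v)
  else True.

Definition poly_map (V : nmodType) (d : nat) (f : V -> A) : Prop :=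
  forall N, poly_upto N d f.

Section PolyUpto.

Variable V : nmodType.
Implicit Types (f g : V -> A) (N d : nat).

Lemma poly_upto_val N d f : poly_upto N d f -> forall v, fil d (f v).
Proof. by case: N => [|N] []. Qed.

Lemma poly_upto_ext N d f g : f =1 g -> poly_upto N d f -> poly_upto N d g.
Proof. by move=> /funext ->. Qed.

Lemma poly_upto_decr N d f : poly_upto N d.+1 f -> poly_upto N d f.
Proof.
elim: N d f => [|N IH] d f [fd hf];
  (split=> //; first by move=> v; apply: brace_pow_decr).
by move=> h; apply/IH/hf.
Qed.

Lemma poly_upto_mono N d e f : (d <= e)%N -> poly_upto N e f -> poly_upto N d f.
Proof.
move=> /subnK <-; elim: (e - d)%N => // n IH; rewrite addSn => /poly_upto_decr.
exact: IH.
Qed.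

Lemma poly_upto_pred N d f : poly_upto N.+1 d f -> poly_upto N d f.
Proof.
elim: N d f => [|N IH] d f [fd hf]; split=> // h; exact/IH/hf.
Qed.

Lemma poly_upto0 N d : poly_upto N d (fun _ : V => 0).
Proof.
elim: N d => [|N IH] d; (split=> //; first by move=> _; apply: brace_pow0).
by move=> h; apply: poly_upto_ext (IH d.+1) => v; rewrite subrr.
Qed.

Lemma poly_upto_cst N d a : fil d a -> poly_upto N d (fun _ : V => a).
Proof.
case: N => [|N] fa; split=> // h.
by apply: poly_upto_ext (poly_upto0 N d.+1) => v; rewrite subrr.
Qed.

Lemma poly_uptoD N d f g :
  poly_upto N d f -> poly_upto N d g -> poly_upto N d (fun v => f v + g v).
Proof.
elim: N d f g => [|N IH] d f g [fd hf] [gd hg];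
  (split=> //; first by move=> v; apply: brace_powD).
move=> h; apply: poly_upto_ext (IH _ _ _ (hf h) (hg h)) => v.
by rewrite opprD addrACA.
Qed.

Lemma poly_uptoN N d f : poly_upto N d f -> poly_upto N d (fun v => - f v).
Proof.
elim: N d f => [|N IH] d f [fd hf];
  (split=> //; first by move=> v; apply: brace_powN).
by move=> h; apply: poly_upto_ext (IH _ _ (hf h)) => v; rewrite opprD.
Qed.

Lemma poly_uptoB N d f g :
  poly_upto N d f -> poly_upto N d g -> poly_upto N d (fun v => f v - g v).
Proof. by move=> pf pg; apply: poly_uptoD => //; apply: poly_uptoN. Qed.

Lemma poly_upto_mulrn N d f n :
  poly_upto N d f -> poly_upto N d (fun v => f v *+ n).
Proof.
move=> pf; elim: n => [|n IH]; first exact: poly_upto0.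
by apply: poly_upto_ext (poly_uptoD pf IH) => v; rewrite mulrS.
Qed.

Lemma poly_upto_sum N d (I : Type) (r : seq I) (F : I -> V -> A) :
  (forall i, poly_upto N d (F i)) ->
  poly_upto N d (fun v => \sum_(i <- r) F i v).
Proof.
move=> pF; elim: r => [|i r IH].
  by apply: poly_upto_ext (poly_upto0 N d) => v; rewrite big_nil.
by apply: poly_upto_ext (poly_uptoD (pF i) IH) => v; rewrite big_cons.
Qed.

Lemma poly_upto_shift N d f h :
  poly_upto N.+1 d f -> poly_upto N d (fun v => f (v + h)).
Proof.
move=> pf; have [_ /(_ h) /poly_upto_decr pd] := pf.
apply: poly_upto_ext (poly_uptoD pd (poly_upto_pred pf)) => v.
by rewrite subrK.
Qed.

(** A monomial [c *+ t ^ n] has degree [n] in [t], and is therefore polynomial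
    as soon as [c] lies in [A^[n]]; this is one step towards it. *)
Lemma poly_upto_mull N d f (m : V -> nat) :
  {morph m : v w / (v + w)%R >-> (v + w)%N} ->
  poly_upto N d.+1 f -> poly_upto N d (fun v => f v *+ m v).
Proof.
move=> mD; elim: N d f => [|N IH] d f pf;
  (split=> //; first by move=> v; apply: brace_pow_mulrn => //;
     apply: brace_pow_decr => //; apply: (poly_upto_val pf)).
move=> h; have [_ /(_ h) pd] := pf.
have ps := poly_upto_mulrn (m h) (poly_upto_shift h pf).
apply: poly_upto_ext (poly_uptoD (IH _ _ pd) ps) => v.
by rewrite mD mulrnDr mulrnBl addrAC.
Qed.

(** [f] and [g] being polynomial, so is [f ** g].  The difference of [f ** g]
    in direction [h] is [f (v + h) ** (g (v + h) - g v)] plus the defect of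
    additivity of [**] on the left.  Writing [f (v + h)] as the circle product
    of [f v] and [u v], that defect is [z + f v ** z] with [z = u v ** g v];
    and [u v] solves [u + f ** u = f (v + h) - f v], an equation whose right
    side has gained one step in the filtration. *)
Lemma poly_upto_star N i j f g :
  poly_upto N i f -> poly_upto N j g ->
  poly_upto N (i + j) (fun v => f v ** g v).
Proof.
elim: N i j f g => [|N IH] i j f g pf pg;
  (split=> //; first by move=> v; apply: brace_pow_star => //;
     [apply: (poly_upto_val pf) | apply: (poly_upto_val pg)]).
move=> h; have [_ /(_ h) pdf] := pf; have [_ /(_ h) pdg] := pg.
have pf' := poly_upto_pred pf; have pg' := poly_upto_pred pg.
have /choice[u hu] : forall v, exists w, f (v + h) = circ (f v) w /\
    w + f v ** w = f (v + h) - f v.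
  move=> v.
  have [w w1 w2] := add_circ_decomp circ_brace (f v) (f (v + h) - f v).
  by exists w; split=> //; rewrite -w1 [RHS]addrC subrK.
have pu : poly_upto N i.+1 u.
  (* The equation for [u] is solved by iteration from 0: the error of [w r]
     lies in [A^[r]], so [w k] is the solution. *)
  pose w r := iter r (fun x v => f (v + h) - f v - f v ** x v) (fun=> 0).
  have pw r : poly_upto N i.+1 (w r).
    elim: r => [|r IHr] /=; first exact: poly_upto0.
    apply: poly_uptoB => //; apply: poly_upto_mono (IH _ _ _ _ pf' IHr).
    exact: leq_addl.
  apply: poly_upto_ext (pw k) => v; apply/esym/subr0_eq.
  apply: (brace_pow_nilp (leqnn k)).
  elim: (k) => [|r IHr]; first exact: brace_pow_le1.
  rewrite /= -(hu v).2 opprB addrCA opprD [u v + _]addrA subrr add0r.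
  rewrite -opprB -starBr //; apply: brace_powN => //.
  exact: brace_pow_starS.
have pz := IH _ _ _ _ pu pg'.
have pdz := poly_uptoD pz (poly_upto_mono (leq_addl i _) (IH _ _ _ _ pf' pz)).
have := IH _ _ _ _ (poly_upto_shift h pf) pdg; rewrite addnS => pe.
rewrite addSn in pdz.
apply: poly_upto_ext (poly_uptoD pe pdz) => v.
rewrite [f (v + h)](hu v).1 starBr // !(star_circ circ_brace _ _ (g v)).
by rewrite -[f v ** g v + _ + _]addrA opprD [X in X + _ = _]addrA subrK.
Qed.

End PolyUpto.

Lemma poly_upto_pull (V W : nmodType) N d (f : W -> A) (m : V -> W) :
  {morph m : v w / v + w} ->
  poly_upto N d f -> poly_upto N d (fun v => f (m v)).
Proof.
move=> mD; elim: N d f => [|N IH] d f [fd hf]; split=> // h.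
by apply: poly_upto_ext (IH _ _ (hf (m h))) => v; rewrite mD.
Qed.

End FilteredPolynomialMaps.

(** * Binomial polynomials and geometric sums over the prime field *)

Section PrimeFieldScalars.

Variable p : nat.
Hypothesis p_prime : prime p.

Lemma natr_Fp_eq m n : (m < p)%N -> (n < p)%N ->
  (m%:R == n%:R :> 'F_p) = (m == n).
Proof.
move=> mp np; apply/eqP/eqP => [/(congr1 (@nat_of_ord _))|-> //].
by rewrite !val_Fp_nat // !modn_small.
Qed.

Lemma natr_Fp_neq0 n : (0 < n < p)%N -> n%:R != 0 :> 'F_p.
Proof.
case/andP=> n0 np; rewrite (@natr_Fp_eq n 0) ?prime_gt0 //.
by rewrite -lt0n.
Qed.

Lemma fact_Fp_neq0 n : (n < p)%N -> n`!%:R != 0 :> 'F_p.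
Proof.
elim: n => [|n IH] np; first by rewrite oner_neq0.
by rewrite factS natrM mulf_neq0 ?IH 1?ltnW // natr_Fp_neq0.
Qed.

Lemma geometric_sum_Fp (r : 'F_p) : r != 0 ->
  \sum_(i < p.-1) r ^+ i = if r == 1 then -1 else 0.
Proof.
move=> r0; case: eqP => [->|/eqP r1].
  rewrite (eq_bigr (fun _ => 1)) => [|i _]; last by rewrite expr1n.
  rewrite sumr_const card_ord -subn1 natrB ?prime_gt0 //.
  by rewrite pchar_Fp_0 // sub0r.
apply: (@mulfI _ (r - 1)); first by rewrite subr_eq0.
rewrite mulr0 -subrX1; apply: (mulfI r0).
have rp : r ^+ p = r by have := expf_card r; rewrite card_Fp.
by rewrite mulrBr -exprS prednK ?prime_gt0 // rp mulr1 subrr mulr0.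
Qed.

Definition binomial_poly (i : nat) : {poly 'F_p} :=
  (i`!%:R)^-1 *: \prod_(j < i) ('X - (j%:R)%:P).

Lemma size_binomial_poly i : (size (binomial_poly i) <= i.+1)%N.
Proof.
rewrite (leq_trans (size_scale_leq _ _)) // size_prod_XsubC.
by rewrite /index_enum -enumT size_enum_ord.
Qed.

Lemma horner_binomial_poly i t : (i < p)%N ->
  (binomial_poly i).[t%:R] = 'C(t, i)%:R.
Proof.
move=> ip; rewrite hornerZ horner_prod.
apply: (mulfI (fact_Fp_neq0 ip)); rewrite mulVKf ?fact_Fp_neq0 //.
rewrite -natrM mulnC bin_ffact ffact_prod natr_prod.
under eq_bigr do rewrite hornerXsubC.
have [it|ti] := leqP i t.
  by apply: eq_bigr => j _; rewrite natrB // ltnW // (leq_trans _ it).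
rewrite (bigD1 (Ordinal ti)) //= subrr mul0r.
by rewrite (bigD1 (Ordinal ti)) //= subnn mul0r.
Qed.

End PrimeFieldScalars.

Section Newton.

Variable A : zmodType.

Definition fdiff (f : nat -> A) (t : nat) : A := f t.+1 - f t.

Lemma newton_expansion n (f : nat -> A) t :
  (forall u, iter n fdiff f u = 0) ->
  f t = \sum_(i < n) iter i fdiff f 0%N *+ 'C(t, i).
Proof.
elim: t n f => [|t IH] n f fn.
  case: n fn => [|n] fn; first by rewrite big_ord0; apply: fn.
  by rewrite big_ord_recl bin0 big1 ?addr0 // => i _; rewrite bin0n.
have -> : f t.+1 = f t + fdiff f t by rewrite addrC subrK.
rewrite (IH n f) // (IH n (fdiff f)); last first.
  by move=> u; rewrite -iterSr iterS /fdiff !fn subrr.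
case: n fn => [|n] fn; first by rewrite !big_ord0 addr0.
rewrite [X in _ + X]big_ord_recr /= -iterSr fn mul0rn addr0 !big_ord_recl !bin0.
rewrite -addrA -big_split; congr (_ + _); apply: eq_bigr => i _.
by rewrite /= /bump add1n binS mulrnDr -iterSr.
Qed.

End Newton.

(** * The linear coefficient of a polynomial map *)

Section LinearCoefficient.

Variables (p k : nat) (A : lmodType 'F_p).
Hypothesis p_prime : prime p.
Hypothesis p_large : (2 ^ k < p)%N.

Lemma scale_FpE (c : 'F_p) (a : A) : c *: a = a *+ c.
Proof. by rewrite -scaler_nat natr_Zp. Qed.

Lemma lt_k_p : (k < p)%N.
Proof. exact: leq_ltn_trans (ltnW (ltn_expl k (ltnSn 1))) p_large. Qed.

Definition lin_coef (f : nat -> A) : A :=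
  - \sum_(i < p.-1) ((2 ^ i)%N%:R : 'F_p)^-1 *: f (2 ^ i)%N.

Lemma eq_lin_coef f g : f =1 g -> lin_coef f = lin_coef g.
Proof. by move=> /funext ->. Qed.

Lemma lin_coefD f g :
  lin_coef (fun t => f t + g t) = lin_coef f + lin_coef g.
Proof.
rewrite /lin_coef -opprD -big_split; congr (- _); apply: eq_bigr => i _.
by rewrite scalerDr.
Qed.

Lemma lin_coef0 : lin_coef (fun=> 0) = 0.
Proof. by rewrite /lin_coef big1 ?oppr0 // => i _; rewrite scaler0. Qed.

Lemma lin_coef_sum (I : Type) (r : seq I) (f : I -> nat -> A) :
  lin_coef (fun t => \sum_(i <- r) f i t) = \sum_(i <- r) lin_coef (f i).
Proof.
elim: r => [|i r IH].
  by rewrite big_nil -[RHS]lin_coef0; apply: eq_lin_coef => t; rewrite big_nil.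
by rewrite big_cons -IH -lin_coefD; apply: eq_lin_coef => t; rewrite big_cons.
Qed.

Lemma lin_coef_morph (g : A -> A) f : linear g ->
  lin_coef (fun t => g (f t)) = g (lin_coef f).
Proof.
move=> g_lin; have gD a b : g (a + b) = g a + g b.
  by rewrite -[a]scale1r g_lin !scale1r.
have g0 : g 0 = 0 by apply: (addrI (g 0)); rewrite -gD !addr0.
have gZ c a : g (c *: a) = c *: g a by rewrite -[_ *: a]addr0 g_lin g0 addr0.
have gN a : g (- a) = - g a by rewrite -scaleN1r gZ scaleN1r.
rewrite /lin_coef gN (big_morph g gD g0); congr (- _); apply: eq_bigr => i _.
by rewrite gZ.
Qed.

Lemma lin_coefC (F : nat -> nat -> A) :
  lin_coef (fun t => lin_coef (fun s => F t s)) =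
  lin_coef (fun s => lin_coef (fun t => F t s)).
Proof.
rewrite /lin_coef; congr (- _).
under eq_bigr do rewrite scalerN scaler_sumr -sumrN.
under [RHS]eq_bigr do rewrite scalerN scaler_sumr -sumrN.
rewrite exchange_big; apply: eq_bigr => j _; apply: eq_bigr => i _ /=.
by rewrite !scalerA mulrC.
Qed.

(** The sum in [lin_coef] is geometric of ratio [r = 2 ^ m / 2].  If [r != 1] it
    vanishes because [r ^ p.-1 = 1]; and as [2 ^ m < p], [r = 1] only for
    [m = 1], where the sum is [p - 1 = -1]. *)
Lemma lin_coef_monomial m (a : A) : (m < k)%N ->
  lin_coef (fun t => a *+ t ^ m) = if m == 1%N then a else 0.
Proof.
move=> mk; have lt2p : (2 < p)%N.
  apply: leq_ltn_trans p_large.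
  by rewrite -{1}(expn1 2) leq_exp2l // (leq_trans _ mk).
have ltmp : (2 ^ m < p)%N.
  by apply: leq_ltn_trans p_large; rewrite leq_exp2l // ltnW.
have n2 : 2%:R != 0 :> 'F_p by rewrite natr_Fp_neq0.
have nm : (2 ^ m)%N%:R != 0 :> 'F_p by rewrite natr_Fp_neq0 // expn_gt0.
have -> : lin_coef (fun t => a *+ t ^ m) =
   - (\sum_(i < p.-1) ((2 ^ m)%N%:R / 2%:R) ^+ i) *: a.
  rewrite /lin_coef scaleNr scaler_suml; congr (- _); apply: eq_bigr => i _.
  rewrite -scaler_nat scalerA; congr (_ *: _).
  by rewrite expr_div_n -!natrX mulrC -!expnM mulnC.
rewrite geometric_sum_Fp //; last by rewrite mulf_neq0 ?invr_eq0.
have -> : ((2 ^ m)%N%:R / 2%:R == 1 :> 'F_p) = (m == 1%N).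
  rewrite -(inj_eq (mulIf n2)) mulfVK // mul1r natr_Fp_eq //.
  by rewrite -{2}(expn1 2) eqn_exp2l.
by case: eqP; rewrite ?opprK ?scale1r // oppr0 scale0r.
Qed.

End LinearCoefficient.

(** * Expansion of polynomial maps in monomials *)

Section Flows.

Variables (p k : nat) (A : lmodType 'F_p) (circ : A -> A -> A).
Hypotheses (p_prime : prime p) (p_large : (2 ^ k < p)%N) (k_gt0 : (0 < k)%N).
Hypothesis circ_field_brace : field_brace circ.
Hypothesis nilp : brace_pow circ k = [set 0]%classic.

Let circ_brace : left_brace circ := circ_field_brace.1.

Local Notation "a ** b" := (brace_star circ a b) (at level 40).
Local Notation fil := (brace_pow circ).
Local Notation poly_map := (poly_map circ).
Local Notation dot := (brace_dot circ).

(** Newton's formula in the variable [t], followed by expansion of the binomial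
    polynomials, whose denominators divide [i`!] with [i < k < p].  The
    parameter [v] makes it possible to iterate this for several variables. *)
Lemma poly_map_expansion_param (V : nmodType) d (F : nat * V -> A) :
  poly_map d F ->
  exists c : nat -> V -> A, (forall m, poly_map (m + d) (c m)) /\
    forall t v, F (t, v) = \sum_(m < k) c m v *+ t ^ m.
Proof.
move=> pF; pose delta i v := iter i (@fdiff A) (fun t => F (t, v)).
have pdelta i : poly_map (i + d) (fun x : nat * V => delta i x.2 x.1).
  elim: i => [|i IH] N.
    by apply: poly_upto_ext (pF N) => -[].
  have [_ /(_ (1%N, 0))] := IH N.+1; apply: poly_upto_ext => -[t v].
  by rewrite /= /delta /= /fdiff addr0 -[(t + 1)%R]/(t + 1)%N addn1.
have pdelta0 i : poly_map (i + d) (fun v : V => delta i v 0%N).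
  move=> N.
  by apply: (poly_upto_pull (m := fun v : V => (0%N, v)) _ (pdelta i N)).
exists (fun m v => \sum_(i < k) (binomial_poly p i)`_m *: delta i v 0%N); split.
  move=> m N; apply: (@poly_upto_sum _ _ circ_brace V N (m + d) _ _
    (fun (i : 'I_k) v => (binomial_poly p i)`_m *: delta i v 0%N)) => i.
  have [mi|im] := leqP m i.
    apply: (@poly_upto_ext _ _ _ _ _
      (fun v => delta i v 0%N *+ ((binomial_poly p i)`_m)%R)).
      by move=> v; rewrite scale_FpE.
    apply: poly_upto_mulrn => //; apply: poly_upto_mono (pdelta0 i N) => //.
    by rewrite leq_add2r.
  apply: poly_upto_ext (poly_upto0 circ_brace V N (m + d)) => v.
  by rewrite nth_default ?scale0r // (leq_trans (size_binomial_poly _ _)).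
move=> t v.
rewrite (@newton_expansion _ k (fun t => F (t, v)) t); last first.
  move=> u; apply: (brace_pow_nilp circ_brace nilp (leq_addr d k)).
  exact: (poly_upto_val (pdelta k 0%N) (u, v)).
under [RHS]eq_bigr => m _ do rewrite -sumrMnl.
rewrite exchange_big; apply: eq_bigr => i _ /=.
rewrite -scaler_nat -(horner_binomial_poly p_prime); last first.
  exact: ltn_trans (ltn_ord i) (lt_k_p p_large).
rewrite (@horner_coef_wide _ k); last first.
  exact: leq_trans (size_binomial_poly _ _) (ltn_ord i).
rewrite scaler_suml; apply: eq_bigr => m _.
by rewrite -scaler_nat scalerA natrX mulrC.
Qed.

Lemma poly_map_expansion d (f : nat -> A) :
  poly_map d f ->
  exists c : nat -> A, (forall m, fil (m + d) (c m)) /\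
    forall t, f t = \sum_(m < k) c m *+ t ^ m.
Proof.
move=> pf; have pF : poly_map d (fun x : nat * nat => f x.1).
  by move=> N; apply: poly_upto_pull (pf N).
have [c [hc fE]] := poly_map_expansion_param pF.
exists (fun m => c m 0%N); split=> [m|t].
  exact: poly_upto_val (hc m 0%N) _.
exact: (fE t 0%N).
Qed.

Lemma lin_coef_cst (a : A) : lin_coef (fun=> a) = 0.
Proof. exact: (lin_coef_monomial p_prime p_large a k_gt0). Qed.

Lemma lin_coef_eq0 (f : nat -> A) : (forall t, f t = 0) -> lin_coef f = 0.
Proof. by move=> f0; rewrite (eq_lin_coef f0) lin_coef_cst. Qed.

(** The monomials [t ^ m * s ^ n] with [m + n = 1] are [t] and [s], those of
    larger total degree have no linear coefficient on the diagonal.  Only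
    degrees below [k] occur because the coefficient of [t ^ m * s ^ n] lies in
    [A^[m + n]]: bounds on the degrees in [t] and in [s] separately would not
    suffice. *)
Lemma lin_coef_diag (F : nat * nat -> A) :
  poly_map 0 F ->
  lin_coef (fun t => F (t, t)) =
  lin_coef (fun t => F (t, 0%N)) + lin_coef (fun t => F (0%N, t)).
Proof.
move=> /poly_map_expansion_param[c [hc FE]].
have /choice[c2 hc2] : forall m, exists c' : nat -> A,
    (forall n, fil (n + m) (c' n)) /\
    forall s, c m s = \sum_(n < k) c' n *+ s ^ n.
  by move=> m; apply: poly_map_expansion; have := hc m; rewrite addn0.
have {}FE t s : F (t, s) = \sum_(m < k) \sum_(n < k) c2 m n *+ s ^ n *+ t ^ m.
  by rewrite FE; apply: eq_bigr => m _; rewrite (hc2 m).2 sumrMnl.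
have {}FE (g h : nat -> nat) : lin_coef (fun t => F (g t, h t)) =
    \sum_(m < k) \sum_(n < k) lin_coef (fun t => c2 m n *+ h t ^ n *+ g t ^ m).
  rewrite (eq_lin_coef (fun t => FE (g t) (h t))).
  rewrite (lin_coef_sum _ (fun (m : 'I_k) t =>
    \sum_(n < k) c2 m n *+ h t ^ n *+ g t ^ m)).
  apply: eq_bigr => m _.
  exact: (lin_coef_sum _ (fun (n : 'I_k) t => c2 m n *+ h t ^ n *+ g t ^ m)).
rewrite (FE id id) (FE id (fun=> 0%N)) (FE (fun=> 0%N) id) -big_split.
apply: eq_bigr => m _; rewrite -big_split; apply: eq_bigr => n _ /=.
have := (hc2 m).1 n; move: (c2 m n) => a fa.
have [mnk|] := ltnP (n + m) k; last first.
  move=> /(brace_pow_nilp circ_brace nilp)/(_ fa) ->.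
  by rewrite !lin_coef_eq0 ?addr0 // => t; rewrite !mul0rn.
case: m n mnk fa => [[|m] mk] [[|n] nk] mnk fa /=.
- by rewrite !(lin_coef_cst a) addr0.
- by rewrite [X in _ = X + _]lin_coef_eq0 ?add0r // => t; rewrite exp0n ?mulr0n.
- by rewrite [X in _ = _ + X]lin_coef_eq0 ?addr0 // => t; rewrite exp0n ?mulr0n.
rewrite [X in _ = _ + X]lin_coef_eq0 => [|t]; last by rewrite exp0n ?mulr0n.
rewrite [X in _ = X + _]lin_coef_eq0 => [|t]; last first.
  by rewrite exp0n // mulr0n mul0rn.
rewrite addr0; have := lin_coef_monomial p_prime p_large a mnk.
rewrite addSn addnS /= => <-; apply: eq_lin_coef => t.
by rewrite -mulrnA -expnD addSn addnS.
Qed.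

(** * The pre-Lie algebra of the brace *)

Lemma star_linear a : linear (brace_star circ a).
Proof. by move=> c u v; rewrite starDr // circ_field_brace.2. Qed.

Lemma lin_coef_starr a f : lin_coef (fun t => a ** f t) = a ** lin_coef f.
Proof. exact/lin_coef_morph/star_linear. Qed.

Lemma dotE a b : dot a b = lin_coef (fun t => (a *+ t) ** b).
Proof. by []. Qed.

Lemma dot_linear a : linear (dot a).
Proof.
move=> c u v; have cl : linear (fun x : A => c *: x).
  by move=> e x y; rewrite scalerDr !scalerA mulrC.
rewrite !dotE -(lin_coef_morph _ cl) -lin_coefD.
by apply: eq_lin_coef => t; apply: star_linear.
Qed.

Lemma poly_map_pow (V : nmodType) (m : V -> nat) n d (f : V -> A) :
  {morph m : v w / (v + w)%R >-> (v + w)%N} ->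
  poly_map (n + d) f -> poly_map d (fun v => f v *+ m v ^ n).
Proof.
move=> mD; elim: n d => [|n IH] d pf; first by [].
move=> N; have pf' : poly_map (n + d.+1) f by rewrite addnS.
apply: poly_upto_ext (poly_upto_mull circ_brace mD (IH _ pf' N)) => v.
by rewrite -mulrnA expnSr.
Qed.

Lemma poly_map_mul (V : nmodType) (m : V -> nat) (a : A) :
  {morph m : v w / (v + w)%R >-> (v + w)%N} ->
  poly_map 0 (fun v => a *+ m v).
Proof.
move=> mD N; apply: poly_upto_mull => //; apply: poly_upto_cst => //.
Qed.

Lemma poly_map0_star (V : nmodType) (f : V -> A) b :
  poly_map 0 f -> poly_map 0 (fun v => f v ** b).
Proof.
move=> pf N; apply: (poly_upto_star circ_brace nilp (pf N)).
exact: poly_upto_cst.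
Qed.

Lemma fst_morph :
  {morph (fun x : nat * nat => x.1) : v w / (v + w)%R >-> (v + w)%N}.
Proof. by []. Qed.

Lemma snd_morph :
  {morph (fun x : nat * nat => x.2) : v w / (v + w)%R >-> (v + w)%N}.
Proof. by []. Qed.

Lemma lin_coef_starD (a x y b : A) :
  lin_coef (fun t => (a + x *+ t + y *+ t) ** b) =
  lin_coef (fun t => (a + x *+ t) ** b) + lin_coef (fun t => (a + y *+ t) ** b).
Proof.
rewrite (@lin_coef_diag (fun v => (a + x *+ v.1 + y *+ v.2) ** b)) /=.
  by congr (_ + _); apply: eq_lin_coef => t; rewrite ?addr0.
apply: poly_map0_star => N; apply: poly_uptoD => //.
  apply: poly_uptoD => //; first exact: poly_upto_cst.
  exact: poly_map_mul fst_morph N.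
exact: poly_map_mul snd_morph N.
Qed.

Lemma dotDl x y b : dot (x + y) b = dot x b + dot y b.
Proof.
have := lin_coef_starD 0 x y b; rewrite !dotE.
under eq_lin_coef do rewrite add0r -mulrnDl.
under [X in _ = X + _ -> _]eq_lin_coef do rewrite add0r.
by under [X in _ = _ + X -> _]eq_lin_coef do rewrite add0r.
Qed.

Lemma dot0l b : dot 0 b = 0.
Proof. by apply: (addrI (dot 0 b)); rewrite -dotDl !addr0. Qed.

Lemma dot_linearl b : linear (dot^~ b).
Proof.
move=> c u v; rewrite dotDl !scale_FpE; congr (_ + _).
elim: (nat_of_ord c) => [|n IH]; first exact: dot0l.
by rewrite !mulrS dotDl IH.
Qed.

Lemma lin_coef_dotl f b : lin_coef (fun t => dot (f t) b) = dot (lin_coef f) b.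
Proof. exact: (lin_coef_morph _ (dot_linearl b)). Qed.

Lemma dot_pre_lie : pre_lie dot.
Proof.
split; [exact: dot_linear | exact: dot_linearl |].
(* The coefficient of [t * s] in [(t x + s y) ** z]. *)
pose S x y z := lin_coef (fun t => lin_coef (fun s => (x *+ t + y *+ s) ** z)).
have S_sym x y z : S x y z = S y x z.
  rewrite /S lin_coefC; apply: eq_lin_coef => t; apply: eq_lin_coef => s.
  by rewrite addrC.
suff dot_dot x y z : dot x (dot y z) = S x y z + dot (dot x y) z.
  by move=> x y z; rewrite !dot_dot S_sym !opprD !(addrCA _ (- S _ _ _)) !subrr.
have -> : dot x (dot y z) =
    lin_coef (fun t => lin_coef (fun s => circ (x *+ t) (y *+ s) ** z)).
  transitivity (lin_coef (fun t => dot y z + (x *+ t) ** dot y z)).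
    by rewrite lin_coefD lin_coef_cst add0r.
  apply: eq_lin_coef => t.
  under [RHS]eq_lin_coef do rewrite (star_circ circ_brace).
  by rewrite 2!lin_coefD lin_coef_cst add0r lin_coef_starr.
rewrite lin_coefC.
transitivity (lin_coef (fun s =>
    lin_coef (fun t => (y *+ s + x *+ t) ** z) +
    lin_coef (fun t => ((y + (x *+ t) ** y) *+ s) ** z))).
  apply: eq_lin_coef => s.
  (* The two occurrences of [t], in [t x] and in [t x ** y], are treated as
     independent variables. *)
  pose F (v : nat * nat) := (y *+ s + x *+ v.1 + ((x *+ v.2) ** y) *+ s) ** z.
  have pF : poly_map 0 F.
    apply: poly_map0_star => N; apply: poly_uptoD => //.
      apply: poly_uptoD => //; first exact: poly_upto_cst.
      exact: poly_map_mul fst_morph N.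
    apply: poly_upto_mulrn => //.
    exact: poly_map0_star (poly_map_mul x snd_morph) N.
  transitivity (lin_coef (fun t => F (t, t))).
    apply: eq_lin_coef => t; rewrite /F /= [circ (x *+ t) _]circE.
    congr (brace_star circ _ z).
    by rewrite starMnr // [x *+ t + _]addrC.
  rewrite (lin_coef_diag pF) /F /=; congr (_ + _); apply: eq_lin_coef => t.
    by rewrite star0r // mul0rn addr0.
  by rewrite mulr0n addr0 [in RHS]mulrnDl.
rewrite lin_coefD S_sym; congr (_ + _); rewrite lin_coefC.
transitivity (lin_coef (fun t => dot y z + dot ((x *+ t) ** y) z)).
  by apply: eq_lin_coef => t; rewrite -dotDl.
by rewrite lin_coefD lin_coef_cst add0r lin_coef_dotl.
Qed.

Lemma brace_pow_lin_coef d f : (forall t, fil d (f t)) -> fil d (lin_coef f).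
Proof.
move=> fd; rewrite /lin_coef; apply: (brace_powN circ_brace).
apply: (brace_pow_sum circ_brace) => i _.
by rewrite scale_FpE; apply: brace_pow_mulrn.
Qed.

Lemma brace_pow_dot i j a b : fil i a -> fil j b -> fil (i + j) (dot a b).
Proof.
move=> fa fb; rewrite dotE; apply: brace_pow_lin_coef => t.
by apply: brace_pow_star => //; apply: brace_pow_mulrn.
Qed.

Lemma bracketed_brace_pow n z : bracketed_product dot n z -> fil n z.
Proof.
by elim=> [a|i j a b _ fa _ fb]; [apply: brace_pow_le1 | apply: brace_pow_dot].
Qed.

(** * Differential calculus along polynomial maps *)

Lemma lin_coef_monomial_star m c b :
  (m < k)%N -> fil m c -> (m = 0%N -> c = 0) ->
  lin_coef (fun t => (c *+ t ^ m) ** b) = dot (if m == 1%N then c else 0) b.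
Proof.
case: m => [|[|m]] mk fc c0.
- by rewrite c0 // dot0l lin_coef_eq0 // => t; rewrite mul0rn star0r.
- by [].
rewrite dot0l.
(* Split [t ^ m.+2] as [t ^ m.+1 * t] and make the two factors independent
   variables: both partial maps are then 0. *)
have pF : poly_map 0 (fun v : nat * nat => (c *+ v.2 *+ v.1 ^ m.+1) ** b).
  apply: poly_map0_star; apply: (poly_map_pow fst_morph) => N.
  apply: (poly_upto_mull circ_brace snd_morph); apply: poly_upto_cst => //.
  by rewrite addn0.
transitivity (lin_coef (fun t => (c *+ t *+ t ^ m.+1) ** b)).
  by apply: eq_lin_coef => t; rewrite -mulrnA -expnS.
rewrite (lin_coef_diag pF) !lin_coef_eq0 ?addr0 // => t /=.
  by rewrite exp0n // mulr0n star0r.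
by rewrite mulr0n mul0rn star0r.
Qed.

(** The chain rule at 0: [f] differs from [t |-> lin_coef f *+ t] by monomials
    of degree at least 2, and these contribute nothing to the coefficient. *)
Lemma lin_coef_star_chain f b : poly_map 0 f -> f 0%N = 0 ->
  lin_coef (fun t => f t ** b) = dot (lin_coef f) b.
Proof.
move=> /poly_map_expansion[c [hc fE]] f0.
have {}hc m : fil m (c m) by have := hc m; rewrite addn0.
have c0 : c 0%N = 0.
  case: (k) k_gt0 fE => // k' _ /(_ 0%N).
  rewrite f0 big_ord_recl big1 ?addr0 //.
  by move=> i _; rewrite exp0n.
rewrite (eq_lin_coef fE).
rewrite (lin_coef_sum _ (fun (m : 'I_k) t => c m *+ t ^ m)).
rewrite (eq_bigr _ (fun (m : 'I_k) _ =>
  lin_coef_monomial p_prime p_large (c m) (ltn_ord m))).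
have /eq_lin_coef -> : forall t, f t ** b = (\sum_(m < k) c m *+ t ^ m) ** b.
  by move=> t; rewrite fE.
have sub_k : (k <= k)%N by [].
elim: {-2}k sub_k => [|n IH] nk.
  by rewrite big_ord0 dot0l lin_coef_eq0 // => t; rewrite big_ord0 star0r.
rewrite big_ord_recr dotDl -(IH (ltnW nk)).
rewrite -lin_coef_monomial_star //; last first.
  by move=> n0; rewrite n0.
pose F (v : nat * nat) := (\sum_(m < n) c m *+ v.1 ^ m + c n *+ v.2 ^ n) ** b.
have pF : poly_map 0 F.
  apply: poly_map0_star => N; apply: poly_uptoD => //.
    apply: (poly_upto_sum circ_brace _
      (F := fun (m : 'I_n) v => c m *+ v.1 ^ m)) => m.
    apply: (poly_map_pow fst_morph) => N'.
    by apply: poly_upto_cst; rewrite ?addn0.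
  apply: (poly_map_pow snd_morph) => N'.
  by apply: poly_upto_cst; rewrite ?addn0.
transitivity (lin_coef (fun t => F (t, t))).
  by apply: eq_lin_coef => t; rewrite big_ord_recr.
rewrite (lin_coef_diag pF) /F; congr (_ + _); apply: eq_lin_coef => t /=.
  case: (n) => [|n']; first by rewrite c0 mul0rn addr0.
  by rewrite exp0n // mulr0n addr0.
rewrite big1 ?add0r // => -[[|m] mn] _ /=; first by rewrite c0 mul0rn.
by rewrite exp0n.
Qed.

Definition nat_deriv (f : nat -> A) (t : nat) : A :=
  lin_coef (fun s => f (t + s)%N).

Lemma nat_deriv_monomial m c t : (m < k)%N ->
  nat_deriv (fun t => c *+ t ^ m) t = c *+ (m * t ^ m.-1).
Proof.
move=> mk.
transitivity (lin_coef (fun s =>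
    \sum_(i < m.+1) c *+ ('C(m, i) * t ^ (m - i)) *+ s ^ i)).
  apply: eq_lin_coef => s; rewrite expnDn -sumrMnr; apply: eq_bigr => i _.
  by rewrite -mulrnA mulnA.
rewrite (lin_coef_sum _ (fun (i : 'I_m.+1) s =>
  c *+ ('C(m, i) * t ^ (m - i)) *+ s ^ i)).
have lin (i : 'I_m.+1) :
    lin_coef (fun s => c *+ ('C(m, i) * t ^ (m - i)) *+ s ^ i) =
    if i == 1%N :> nat then c *+ ('C(m, i) * t ^ (m - i)) else 0.
  apply: (lin_coef_monomial p_prime p_large).
  exact: leq_trans (ltn_ord i) mk.
rewrite (eq_bigr _ (fun i _ => lin i)) -big_mkcond /=.
rewrite (big_ord1_eq _ (fun i => c *+ ('C(m, i) * t ^ (m - i))) 1 m.+1).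
by case: (m) => [|m'] //=; rewrite bin1 subn1.
Qed.

Lemma iter_nat_deriv0 n (c : nat -> A) f : (forall m, (k <= m)%N -> c m = 0) ->
  (forall t, f t = \sum_(m < k) c m *+ t ^ m) ->
  iter n nat_deriv f 0%N = c n *+ n`!.
Proof.
elim: n c f => [|n IH] c f ck fE.
  rewrite /= fE; case: (k) k_gt0 => // k' _.
  rewrite big_ord_recl big1 ?addr0 //.
  by move=> i _; rewrite exp0n.
rewrite iterSr (IH (fun m => c m.+1 *+ m.+1)) => [|m km|t].
- by rewrite -mulrnA factS.
- by rewrite ck ?mul0rn // ltnW.
have -> : nat_deriv f t = \sum_(m < k) c m *+ (m * t ^ m.-1).
  rewrite /nat_deriv; under eq_lin_coef do rewrite fE.
  rewrite (lin_coef_sum _ (fun (m : 'I_k) s => c m *+ (t + s) ^ m)).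
  by apply: eq_bigr => m _; apply: nat_deriv_monomial.
case: (k) ck => [|k'] ck; first by rewrite !big_ord0.
rewrite big_ord_recl mulr0n add0r big_ord_recr /= ck // !mul0rn addr0.
by apply: eq_bigr => m _; rewrite -mulrnA.
Qed.

(** If [f t = \sum_(m < k) c m *+ t ^ m], the [n]-th derivative of [f] at 0 is
    [c n *+ n`!], and [f 1] is the sum of the [c n]. *)
Lemma taylor f : poly_map 0 f ->
  f 1%N = \sum_(n < k) (n`!%:R : 'F_p)^-1 *: iter n nat_deriv f 0%N.
Proof.
move=> /poly_map_expansion[c [hc fE]]; rewrite fE; apply: eq_bigr => n _.
rewrite (iter_nat_deriv0 n _ fE) => [|m km]; last first.
  by apply: (brace_pow_nilp circ_brace nilp km); have := hc m; rewrite addn0.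
rewrite exp1n mulr1n -scaler_nat scalerA mulVf ?scale1r // fact_Fp_neq0 //.
exact: ltn_trans (ltn_ord n) (lt_k_p p_large).
Qed.

(** * The flow of an element *)

Definition circ_pow (a : A) (t : nat) : A := iter t (circ a) 0.

Lemma circ_powD a t s : circ_pow a (t + s) = circ (circ_pow a t) (circ_pow a s).
Proof.
rewrite /circ_pow; elim: t => [|t IH]; first by rewrite circ0r.
by rewrite addSn !iterS IH circA.
Qed.

(** The difference [circ_pow a (v + h) - circ_pow a v] is the image of the
    constant [circ_pow a h] under the action of [circ_pow a v], hence as
    polynomial as [circ_pow a] is, with one degree more: induct on the number of
    differences. *)
Lemma circ_pow_poly a : poly_map 0 (circ_pow a).
Proof.
elim=> [|N IH]; split=> // h.
have ph : poly_upto circ N 1 (fun _ : nat => circ_pow a h).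
  exact: poly_upto_cst.
have := poly_uptoD circ_brace ph (poly_upto_star circ_brace nilp IH ph).
apply: poly_upto_ext => v; rewrite [in RHS]circ_powD (circE circ).
by rewrite [RHS]addrAC [X in _ = X + _]addrAC subrr add0r.
Qed.

Definition circ_log (a : A) : A := lin_coef (circ_pow a).

Definition circ_pow_act (a b : A) (t : nat) : A := b + circ_pow a t ** b.

Lemma circ_pow_act0 a b : circ_pow_act a b 0 = b.
Proof. by rewrite /circ_pow_act star0r // addr0. Qed.

(** The differential equation of the flow: by the action law the derivative at
    [t] is the one at 0 transported by [circ_pow a t], and the latter is
    [dot (circ_log a) b] by the chain rule. *)
Lemma nat_deriv_circ_pow_act a b :
  nat_deriv (circ_pow_act a b) = circ_pow_act a (dot (circ_log a) b).
Proof.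
apply/funext => t; rewrite /nat_deriv /circ_pow_act.
rewrite (eq_lin_coef (g := fun s => b + (circ_pow a t ** b + circ_pow a s ** b +
  circ_pow a t ** (circ_pow a s ** b)))); last first.
  by move=> s; rewrite circ_powD star_circ.
rewrite lin_coefD lin_coef_cst 2!lin_coefD lin_coef_cst !add0r lin_coef_starr.
by rewrite (lin_coef_star_chain _ (circ_pow_poly a)).
Qed.

Lemma iter_nat_deriv_circ_pow_act n a b :
  iter n nat_deriv (circ_pow_act a b) =
  circ_pow_act a (iter n (dot (circ_log a)) b).
Proof. by elim: n => //= n ->; rewrite nat_deriv_circ_pow_act. Qed.

Lemma nat_deriv_circ_pow a :
  nat_deriv (circ_pow a) = circ_pow_act a (circ_log a).
Proof.
apply/funext => t; rewrite /nat_deriv.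
rewrite (eq_lin_coef (g := fun s => circ_pow a t + circ_pow a s +
  circ_pow a t ** circ_pow a s)); last first.
  by move=> s; rewrite circ_powD (circE circ).
by rewrite 2!lin_coefD lin_coef_cst add0r lin_coef_starr.
Qed.

Lemma circ_exp a b :
  b + a ** b = \sum_(n < k) (n`!%:R : 'F_p)^-1 *: iter n (dot (circ_log a)) b.
Proof.
transitivity (circ_pow_act a b 1).
  by rewrite /circ_pow_act /circ_pow /= circr0.
rewrite taylor; last first.
  move=> N; apply: poly_uptoD => //; first exact: poly_upto_cst.
  exact: (poly_map0_star b (circ_pow_poly a)).
by apply: eq_bigr => n _; rewrite iter_nat_deriv_circ_pow_act circ_pow_act0.
Qed.

Lemma circ_log_exp a :
  a = \sum_(n < k.-1)
        (n.+1`!%:R : 'F_p)^-1 *: iter n (dot (circ_log a)) (circ_log a).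
Proof.
transitivity (circ_pow a 1); first by rewrite /circ_pow /= circr0.
rewrite (taylor (circ_pow_poly a)).
case: (k) k_gt0 => // k' _; rewrite big_ord_recl scaler0 add0r.
apply: eq_bigr => n _.
by rewrite iterSr nat_deriv_circ_pow iter_nat_deriv_circ_pow_act circ_pow_act0.
Qed.

(** * The inverse of W *)

Lemma dotBr a b c : dot a (b - c) = dot a b - dot a c.
Proof.
by rewrite [b - c]addrC -[- c]scaleN1r dot_linear scaleN1r [LHS]addrC.
Qed.

Lemma dotBl a b c : dot (a - b) c = dot a c - dot b c.
Proof.
by rewrite [a - b]addrC -[- b]scaleN1r dot_linearl scaleN1r [LHS]addrC.
Qed.

Lemma dot0r a : dot a 0 = 0.
Proof. by have := dotBr a 0 0; rewrite !subrr. Qed.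

Lemma bracketed_iter (T : Type) (f : T -> T -> T) i x b :
  bracketed_product f i.+1 (iter i (f x) b).
Proof.
elim: i => [|i IH]; first exact: Bracketed_leaf.
exact: (@Bracketed_node T f 1 i.+1 x _ (Bracketed_leaf f x) IH).
Qed.

Lemma iter_dot_vanish n x b i :
  (0 < n)%N -> products_vanish dot n -> (n.-1 <= i)%N -> iter i (dot x) b = 0.
Proof.
move=> n_gt0 vn /subnK <-; rewrite iterD.
rewrite [iter n.-1 _ _]vn; last first.
  by rewrite -{1}(prednK n_gt0); apply: bracketed_iter.
by elim: (i - n.-1)%N => //= j ->; rewrite dot0r.
Qed.

Lemma sum_trunc (V : zmodType) m n (g : nat -> V) :
  (forall i, (n <= i)%N -> g i = 0) -> (n <= m)%N ->
  \sum_(i < m) g i = \sum_(i < n) g i.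
Proof.
move=> gn nm; rewrite -!(big_mkord xpredT) (big_cat_nat (leq0n n) nm) /=.
by rewrite [X in _ + X]big_nat [X in _ + X]big1 ?addr0 // => i /andP[/gn].
Qed.

(** [W x - W y] is [x - y] plus terms at least one step deeper in the filtration
    than [x - y]; so [W x = W y] pushes [x - y] down to 0. *)
Lemma flow_W_inj n : (0 < n)%N -> injective (flow_W dot n : A -> A).
Proof.
case: n => // n _ x y Wxy; apply/subr0_eq.
have xy d : fil d (x - y).
  elim: d => [|d IH]; first exact: brace_pow_le1.
  have dotB u v : fil d (u - v) -> fil d.+1 (dot x u - dot y v).
    move=> fuv; have -> : dot x u - dot y v = dot x (u - v) + dot (x - y) v.
      by rewrite dotBr dotBl addrA subrK.
    apply: (brace_powD circ_brace); first exact: (@brace_pow_dot 1 d).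
    by rewrite -[d.+1]addn1; apply: (@brace_pow_dot d 1).
  have iterB i : fil d (iter i (dot x) x - iter i (dot y) y).
    elim: i => [//|i /dotB]; exact: brace_pow_decr.
  move: Wxy; rewrite /flow_W !big_ord_recl /= invr1 !scale1r.
  move=> /(congr1 (fun z => z - y)).
  rewrite addrAC [X in _ = X]addrAC subrr add0r => /(canRL (addrK _)) ->.
  rewrite -sumrB; apply: (brace_pow_sum circ_brace) => i _.
  rewrite -scalerBr scale_FpE; apply: (brace_pow_mulrn circ_brace).
  by rewrite -opprB; apply: (brace_powN circ_brace); exact: dotB (iterB i).
exact: (brace_pow_nilp circ_brace nilp (leqnn k)).
Qed.

(** The nilpotency index [n] of the pre-Lie algebra may be smaller than [k];
    [sum_trunc] reconciles the truncations at [k] and at [n]. *)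
Lemma circ_group_of_flows : group_of_flows dot circ.
Proof.
have vk : products_vanish dot k.
  move=> z /bracketed_brace_pow.
  exact: (brace_pow_nilp circ_brace nilp (leqnn k)).
have ex_n : exists n, (0 < n)%N && `[< products_vanish dot n >].
  by exists k; rewrite k_gt0; apply/asboolP.
case: (ex_minnP ex_n) => n /andP[n_gt0 /asboolP vn] n_min.
have nk : (n <= k)%N by apply: n_min; rewrite k_gt0; apply/asboolP.
have nk1 : (n.-1 <= k.-1)%N by rewrite -2!subn1 leq_sub2r.
have W_log a : flow_W dot n (circ_log a) = a.
  have dot_n i : (n.-1 <= i)%N ->
      (i.+1`!%:R : 'F_p)^-1 *: iter i (dot (circ_log a)) (circ_log a) = 0.
    by move=> /(iter_dot_vanish _ _ n_gt0 vn) ->; rewrite scaler0.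
  rewrite [RHS]circ_log_exp /flow_W.
  by rewrite (sum_trunc dot_n (leq_pred n)) (sum_trunc dot_n nk1).
exists n; split.
- exact: dot_pre_lie.
- split=> // m m_gt0 vm; apply: n_min; rewrite m_gt0; exact/asboolP.
- exact: leq_ltn_trans nk (lt_k_p p_large).
exists circ_log; split=> //.
- by move=> x; apply: (flow_W_inj n_gt0); rewrite W_log.
move=> a b; rewrite circE -addrA circ_exp; congr (_ + _).
have dot_n i : (n.-1 <= i)%N ->
    (i`!%:R : 'F_p)^-1 *: iter i (dot (circ_log a)) b = 0.
  by move=> /(iter_dot_vanish _ _ n_gt0 vn) ->; rewrite scaler0.
by rewrite /flow_exp (sum_trunc dot_n (leq_pred n))
  (sum_trunc dot_n (leq_trans (leq_pred n) nk)).
Qed.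

End Flows.

Theorem theorem8 (p k : nat) (A : lmodType 'F_p) (circ : A -> A -> A)
    (hp : prime p) (hk : (2 ^ k < p)%N)
    (hbrace : field_brace circ)
    (hnil : brace_nilpotency_index circ k) :
  group_of_flows (brace_dot circ) circ.
Proof.
case: hnil => k_gt0 nilp _.
exact: (circ_group_of_flows hp hk k_gt0 hbrace nilp).
Qed.
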